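(* Let $M\in\mathcal{I}_1$ be bounded, with $4\notin M$ and $\max M\ge5$. Then $\max M\ge7$.
   Context: For a summable sequence $\mathbf{x}=(x_n)$ of positive reals, $\mathcal{A}(\mathbf{x})=\{\sum_{n\in A}x_n: A\subseteq\mathbb{N}\}$ is its achievement set and its cardinal function $f$ assigns to $x\in\mathcal{A}(\mathbf{x})$ the cardinality (a positive integer, $\omega$, or $\mathfrak{c}$) of $\{(\varepsilon_n)\in\{0,1\}^{\mathbb{N}}:\sum\varepsilon_nx_n=x\}$. $\mathcal{I}_1$ is the family of ranges of cardinal functions of such sequences whose achievement set is a single closed interval. A set $M\subseteq\{1,2,\dots\}\cup\{\omega,\mathfrak{c}\}$ is bounded if there is $N\in\mathbb{N}$ with $M\subseteq\{1,\dots,N\}$. *)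

(* Defs.v *)
From Stdlib Require Import Reals List.
Open Scope R_scope.

Definition pos_summable (x : nat -> R) : Prop :=
  (forall n, 0 < x n) /\ exists l, infinite_sum x l.

Definition subsum_is (x : nat -> R) (eps : nat -> bool) (t : R) : Prop :=
  infinite_sum (fun n => if eps n then x n else 0) t.

Definition achievement (x : nat -> R) (t : R) : Prop :=
  exists eps : nat -> bool, subsum_is x eps t.

Definition reps (x : nat -> R) (t : R) (eps : nat -> bool) : Prop :=
  subsum_is x eps t.

Inductive cval : Type :=
| Fin : nat -> cval
| Omega : cval
| Cont : cval.

Definition card_is (P : (nat -> bool) -> Prop) (v : cval) : Prop :=
  match v with
  | Fin n => exists l : list (nat -> bool),
      NoDup l /\ length l = n /\ (forall e, P e <-> In e l)
  | Omega => exists f : nat -> (nat -> bool),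
      (forall i j, f i = f j -> i = j) /\ (forall e, P e <-> exists i, f i = e)
  | Cont => exists f : (nat -> bool) -> (nat -> bool),
      (forall a b, f a = f b -> a = b) /\ (forall e, P e <-> exists a, f a = e)
  end.

Definition cardinal_range (x : nat -> R) (M : cval -> Prop) : Prop :=
  forall v, M v <-> exists t, achievement x t /\ card_is (reps x t) v.

Definition achievement_is_interval (x : nat -> R) : Prop :=
  exists a b, a <= b /\ forall t, achievement x t <-> a <= t <= b.

Definition in_I1 (M : cval -> Prop) : Prop :=
  exists x, pos_summable x /\ achievement_is_interval x /\ cardinal_range x M.

Definition bounded_cset (M : cval -> Prop) : Prop :=
  exists N : nat, forall v, M v -> exists k, v = Fin k /\ (1 <= k <= N)%nat.

(* Main.v *)
(** Sort the sequence and let r_n be its tail sums, so that x_n <= r_(n+1) for all n.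

    If x_n < r_(n+1) infinitely often, every node of the representation tree that is alive on an
    interval of targets splits on a smaller interval; a Baire category argument yields a target all
    of whose live nodes split, hence one with continuum many representations, against boundedness.

    So x_n = r_(n+1) from some point on, and the tail is c/2, c/4, .... The cardinal function is
    then a finite sum of translates of the one of [0, c], which is 2 at inner dyadic points of
    [0, c] and 1 elsewhere on it. Over the germ of an interval on which n translates overlap, it
    takes the value n at generic points and n + n_i at points of the i-th class modulo c Z[1/2],
    where n_i translates belong to that class. If no value is 4 and none exceeds 6, the first point
    to the right of which three translates overlap gives a contradiction; with at most two
    overlapping translates, of different classes, all values are at most 3. *)
Require Import Defs.
From Stdlib Require Import Reals List Lra Lia ZArith Classical.
From Stdlib Require Import ClassicalEpsilon FunctionalExtensionality FinFun.
Open Scope R_scope.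

Lemma choice {A B : Type} (P : A -> B -> Prop) :
  (forall a, exists b, P a b) -> exists f, forall a, P a (f a).
Proof.
  intros H; exists (fun a => proj1_sig (constructive_indefinite_description _ (H a))).
  intros a; exact (proj2_sig (constructive_indefinite_description _ (H a))).
Qed.

(** * Counting the entries of a finite list *)

Fixpoint count (P : R -> Prop) (L : list R) : nat :=
  match L with
  | nil => 0
  | s :: L' => ((if excluded_middle_informative (P s) then 1 else 0) + count P L')%nat
  end.

Ltac decide_counts :=
  repeat match goal with
  | |- context [excluded_middle_informative ?P] =>
      destruct (excluded_middle_informative P)
  end.

Lemma count_app P L1 L2 : count P (L1 ++ L2) = (count P L1 + count P L2)%nat.
Proof. induction L1 as [|s L1 IH]; simpl; [reflexivity|rewrite IH; lia]. Qed.

Lemma count_map P h L : count P (map h L) = count (fun s => P (h s)) L.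
Proof. induction L as [|s L IH]; simpl; [reflexivity|rewrite IH; reflexivity]. Qed.

Lemma count_ext P Q L : (forall s, P s <-> Q s) -> count P L = count Q L.
Proof.
  intros H; induction L as [|s L IH]; simpl; [reflexivity|].
  rewrite IH; decide_counts; firstorder.
Qed.

Lemma count_le P Q L : (forall s, P s -> Q s) -> (count P L <= count Q L)%nat.
Proof.
  intros H; induction L as [|s L IH]; simpl; [lia|].
  decide_counts; solve [lia | exfalso; auto].
Qed.

Lemma count_split P Q T L :
  (forall s, T s <-> P s \/ Q s) -> (forall s, P s -> Q s -> False) ->
  count T L = (count P L + count Q L)%nat.
Proof.
  intros H D; induction L as [|s L IH]; simpl; [reflexivity|].
  specialize (H s); specialize (D s).
  decide_counts; solve [lia | exfalso; tauto].
Qed.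

Lemma count_ex P L : (1 <= count P L)%nat -> exists s, In s L /\ P s.
Proof.
  induction L as [|s L IH]; simpl; [lia|].
  decide_counts; [exists s; auto|].
  intros H; destruct IH as [s' [? ?]]; [lia|exists s'; auto].
Qed.

Lemma count_pos P s L : In s L -> P s -> (1 <= count P L)%nat.
Proof.
  induction L as [|s' L IH]; simpl; [tauto|].
  intros [->|HI] HP; [decide_counts; [lia|tauto]|specialize (IH HI HP); lia].
Qed.

(** A list has finitely many entries, so the thresholds found for them separately have a positive
    minimum. *)
Lemma count_germ (P Q : R -> R -> Prop) L :
  (forall s, exists del, 0 < del /\ forall d, 0 < d < del -> (P d s <-> Q d s)) ->
  exists del, 0 < del /\ forall d, 0 < d < del -> count (P d) L = count (Q d) L.
Proof.
  intros H; induction L as [|s L [e [He IH]]].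
  - exists 1; split; [lra|reflexivity].
  - destruct (H s) as [e' [He' Hs]].
    exists (Rmin e e'); split; [apply Rmin_pos; assumption|].
    intros d Hd; pose proof (Rmin_l e e'); pose proof (Rmin_r e e').
    simpl; rewrite IH by lra; specialize (Hs d ltac:(lra)).
    decide_counts; solve [lia | exfalso; tauto].
Qed.

(** * The group [c Z[1/2]] and its cosets *)

Definition dyadic (c u : R) : Prop := exists (z : Z) (k : nat), u = IZR z * c / 2 ^ k.

Lemma pow2_pos k : 0 < 2 ^ k.
Proof. apply pow_lt; lra. Qed.

Lemma pow2_IZR k : 2 ^ k = IZR (2 ^ Z.of_nat k).
Proof. rewrite <- pow_IZR; reflexivity. Qed.

Lemma dyadic_0 c : dyadic c 0.
Proof. exists 0%Z, 0%nat; simpl; field. Qed.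

Lemma dyadic_self c : dyadic c c.
Proof. exists 1%Z, 0%nat; simpl; field. Qed.

Lemma dyadic_opp c u : dyadic c u -> dyadic c (- u).
Proof.
  intros [z [k ->]]; exists (- z)%Z, k; rewrite opp_IZR.
  pose proof (pow2_pos k); field; lra.
Qed.

Lemma dyadic_add c u v : dyadic c u -> dyadic c v -> dyadic c (u + v).
Proof.
  intros [z [k ->]] [w [l ->]].
  exists (z * 2 ^ Z.of_nat l + w * 2 ^ Z.of_nat k)%Z, (k + l)%nat.
  rewrite plus_IZR, !mult_IZR, <- !pow2_IZR, pow_add.
  pose proof (pow2_pos k); pose proof (pow2_pos l); field; lra.
Qed.

Lemma dyadic_sub c u v : dyadic c u -> dyadic c v -> dyadic c (u - v).
Proof. intros; apply dyadic_add; [assumption|apply dyadic_opp; assumption]. Qed.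

Lemma dyadic_shift c d u : dyadic c d -> (dyadic c (u + d) <-> dyadic c u).
Proof.
  intros Hd; split; intros H; [|apply dyadic_add; assumption].
  replace u with (u + d - d) by ring; apply dyadic_sub; assumption.
Qed.

Lemma scaled_pow_small c q eps :
  1 < q -> 0 < eps -> exists K, forall k, (K <= k)%nat -> c / q ^ k < eps.
Proof.
  intros Hq He.
  destruct (Pow_x_infinity q ltac:(rewrite Rabs_right; lra) (Rabs c / eps + 1)) as [K HK].
  exists K; intros k Hk; specialize (HK k Hk).
  assert (Hp : 0 < q ^ k) by (apply pow_lt; lra).
  rewrite Rabs_right in HK by lra.
  apply Rmult_lt_reg_r with (q ^ k); [assumption|].
  replace (c / q ^ k * q ^ k) with c by (field; lra).
  assert (Rabs c / eps < q ^ k) by lra.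
  assert (Rabs c < eps * q ^ k).
  { replace (Rabs c) with (eps * (Rabs c / eps)) by (field; lra).
    apply Rmult_lt_compat_l; assumption. }
  pose proof (Rle_abs c); lra.
Qed.

Lemma dyadic_dense c u del :
  0 < c -> 0 < del -> exists d, 0 < d < del /\ dyadic c (u + d).
Proof.
  intros Hc Hdel.
  destruct (scaled_pow_small c 2 del ltac:(lra) Hdel) as [k Hk].
  specialize (Hk k (Nat.le_refl k)).
  pose proof (pow2_pos k) as Hp.
  (* [up] rounds to an integer strictly above, by at most 1, so the chosen multiple of [c / 2 ^ k]
     exceeds [u] by at most [c / 2 ^ k]. *)
  set (z := up (u * 2 ^ k / c)).
  destruct (archimed (u * 2 ^ k / c)) as [H1 H2]; fold z in H1, H2.
  set (h := c / 2 ^ k) in *.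
  assert (Hh : 0 < h) by (apply Rdiv_lt_0_compat; lra).
  assert (Eu : u = (u * 2 ^ k / c) * h) by (unfold h; field; lra).
  exists (IZR z * h - u); split; [split|].
  - assert ((u * 2 ^ k / c) * h < IZR z * h) by (apply Rmult_lt_compat_r; lra); lra.
  - assert ((IZR z - u * 2 ^ k / c) * h <= 1 * h) by (apply Rmult_le_compat_r; lra); lra.
  - exists z, k; unfold h; field; lra.
Qed.

(** Clearing denominators gives [2 ^ k (3 ^ (j - i) - 1) = z 3 ^ j]; 3 divides the right side but
    neither factor of the left. *)
Lemma pow3_diff_not_dyadic c i j :
  0 < c -> (i < j)%nat -> ~ dyadic c (c / 3 ^ i - c / 3 ^ j).
Proof.
  intros Hc Hij [z [k Hz]].
  replace j with (i + S (j - S i))%nat in Hz by lia.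
  set (m := (j - S i)%nat) in Hz.
  pose proof (pow2_pos k).
  assert (H3i : 0 < 3 ^ i) by (apply pow_lt; lra).
  assert (H3m : 0 < 3 ^ m) by (apply pow_lt; lra).
  rewrite pow_add in Hz; simpl in Hz.
  assert (E : 2 ^ k * (3 * 3 ^ m - 1) = IZR z * (3 ^ i * (3 * 3 ^ m))).
  { apply Rmult_eq_reg_r with (c / (2 ^ k * (3 ^ i * (3 * 3 ^ m)))).
    - replace (2 ^ k * (3 * 3 ^ m - 1) * (c / (2 ^ k * (3 ^ i * (3 * 3 ^ m)))))
        with (c / 3 ^ i - c / (3 ^ i * (3 * 3 ^ m))) by (field; repeat split; lra).
      rewrite Hz; field; repeat split; lra.
    - apply Rgt_not_eq, Rdiv_lt_0_compat; [lra|].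
      repeat apply Rmult_lt_0_compat; lra. }
  rewrite (pow2_IZR k) in E.
  change 3 with (IZR 3) in E; change 1 with (IZR 1) in E.
  rewrite !pow_IZR in E.
  rewrite <- !mult_IZR, <- minus_IZR, <- !mult_IZR in E.
  apply eq_IZR in E.
  assert (D : (3 | 2 ^ Z.of_nat k * (3 * 3 ^ Z.of_nat m - 1))%Z).
  { rewrite E; exists (z * (3 ^ Z.of_nat i * 3 ^ Z.of_nat m))%Z; ring. }
  assert (A : forall l y, (3 | 2 ^ Z.of_nat l * y)%Z -> (3 | y)%Z).
  { induction l as [|l IH]; intros y Hy.
    - rewrite Z.mul_1_l in Hy; exact Hy.
    - apply IH, (Z.gauss 3 2); [|reflexivity].
      rewrite Nat2Z.inj_succ, Z.pow_succ_r, <- Z.mul_assoc in Hy by lia; exact Hy. }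
  destruct (A _ _ D) as [w Hw]; lia.
Qed.

(** The points t + c / 3^j are pairwise incongruent modulo the group, so each coset catches at most one. *)
Lemma avoid_cosets c t del L :
  0 < c -> 0 < del ->
  exists d, 0 < d < del /\ forall s, In s L -> ~ dyadic c (t + d - s).
Proof.
  intros Hc Hdel.
  assert (A : exists J, forall j, (J <= j)%nat ->
    forall s, In s L -> ~ dyadic c (t + c / 3 ^ j - s)).
  { induction L as [|s L [J HJ]]; [exists 0%nat; simpl; tauto|].
    destruct (classic (exists j, (J <= j)%nat /\ dyadic c (t + c / 3 ^ j - s)))
      as [[j [Hj Hd]]|N].
    - exists (S j); intros i Hi s' [<-|Hs']; [|apply HJ; [lia|assumption]].
      intros Hd'; apply (pow3_diff_not_dyadic c j i Hc ltac:(lia)).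
      replace (c / 3 ^ j - c / 3 ^ i)
        with ((t + c / 3 ^ j - s) - (t + c / 3 ^ i - s)) by ring.
      apply dyadic_sub; assumption.
    - exists J; intros i Hi s' [<-|Hs']; [|apply HJ; assumption].
      intros Hd; apply N; exists i; auto. }
  destruct A as [J HJ].
  destruct (scaled_pow_small c 3 del ltac:(lra) Hdel) as [K HK].
  exists (c / 3 ^ (J + K)); split; [split|].
  - apply Rdiv_lt_0_compat; [assumption|apply pow_lt; lra].
  - apply HK; lia.
  - apply HJ; lia.
Qed.

(** * The cardinal function as a finite stack of translates, and its germs *)

(** If all terms outside a finite set form the sequence c/2, c/4, ..., and [L] lists the subset sums
    of that finite set, then [stack c L] is the cardinal function: each s in [L] contributes the
    number of binary expansions of (t - s) / c, which is 0, 1 or 2. *)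
Definition stack (c : R) (L : list R) (t : R) : nat :=
  (count (fun s => 0 <= t - s <= c)%R L
   + count (fun s => 0 < t - s < c /\ dyadic c (t - s))%R L)%nat.

(** For small [d > 0] the translates containing [t + d] are those with [s <= t < s + c], and [t + d]
    is interior to them, so only the dyadic condition still depends on [d]. The first equation makes
    the covering count constant just to the right of [t]. *)
Lemma stack_right c L t : 0 < c ->
  exists del, 0 < del /\ forall d, 0 < d < del ->
  count (fun s => 0 <= t + d - s < c)%R L = count (fun s => 0 <= t - s < c)%R L /\
  stack c L (t + d) = (count (fun s => 0 <= t - s < c)%R L
    + count (fun s => 0 <= t - s < c /\ dyadic c (t + d - s))%R L)%nat.
Proof.
  intros Hc.
  assert (N : forall s, exists del, 0 < del /\ forall d, 0 < d < del ->
    (0 <= t - s < c -> 0 < t + d - s < c) /\ (0 <= t + d - s <= c -> 0 <= t - s < c)).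
  { intros s.
    destruct (Rlt_le_dec (t - s) 0); [exists (- (t - s)); split; [lra|intros; lra]|].
    destruct (Rlt_le_dec (t - s) c); [exists (c - (t - s)); split; [lra|intros; lra]|].
    exists 1; split; [lra|intros; lra]. }
  destruct (count_germ (fun d s => 0 <= t + d - s < c) (fun _ s => 0 <= t - s < c) L)
    as [d1 [P1 H1]].
  { intros s; destruct (N s) as [e [He Hs]]; exists e; split; [assumption|].
    intros d Hd; specialize (Hs d Hd); split; intros; lra. }
  destruct (count_germ (fun d s => 0 <= t + d - s <= c) (fun _ s => 0 <= t - s < c) L)
    as [d2 [P2 H2]].
  { intros s; destruct (N s) as [e [He Hs]]; exists e; split; [assumption|].
    intros d Hd; specialize (Hs d Hd); split; intros; lra. }
  destruct (count_germ (fun d s => 0 < t + d - s < c /\ dyadic c (t + d - s))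
    (fun d s => 0 <= t - s < c /\ dyadic c (t + d - s)) L) as [d3 [P3 H3]].
  { intros s; destruct (N s) as [e [He Hs]]; exists e; split; [assumption|].
    intros d Hd; specialize (Hs d Hd); split; intros [? ?]; (split; [lra|assumption]). }
  exists (Rmin d1 (Rmin d2 d3)); split.
  - repeat apply Rmin_pos; assumption.
  - intros d Hd; pose proof (Rmin_l d1 (Rmin d2 d3)); pose proof (Rmin_r d1 (Rmin d2 d3)).
    pose proof (Rmin_l d2 d3); pose proof (Rmin_r d2 d3).
    unfold stack; rewrite H1, H2, H3 by lra; split; reflexivity.
Qed.

(** Here the covering translates have [s < t <= s + c]. The left side of the first equation is the
    right covering count at [t - d], so that bounds on right germs pass to left germs. *)
Lemma stack_left c L t : 0 < c ->
  exists del, 0 < del /\ forall d, 0 < d < del ->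
  count (fun s => 0 <= t - d - s < c)%R L = count (fun s => 0 < t - s <= c)%R L /\
  stack c L (t - d) = (count (fun s => 0 < t - s <= c)%R L
    + count (fun s => 0 < t - s <= c /\ dyadic c (t - d - s))%R L)%nat.
Proof.
  intros Hc.
  assert (N : forall s, exists del, 0 < del /\ forall d, 0 < d < del ->
    (0 < t - s <= c -> 0 < t - d - s < c) /\ (0 <= t - d - s <= c -> 0 < t - s <= c)).
  { intros s.
    destruct (Rle_lt_dec (t - s) 0); [exists 1; split; [lra|intros; lra]|].
    destruct (Rle_lt_dec (t - s) c); [exists (t - s); split; [lra|intros; lra]|].
    exists (t - s - c); split; [lra|intros; lra]. }
  destruct (count_germ (fun d s => 0 <= t - d - s < c) (fun _ s => 0 < t - s <= c) L)
    as [d1 [P1 H1]].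
  { intros s; destruct (N s) as [e [He Hs]]; exists e; split; [assumption|].
    intros d Hd; specialize (Hs d Hd); split; intros; lra. }
  destruct (count_germ (fun d s => 0 <= t - d - s <= c) (fun _ s => 0 < t - s <= c) L)
    as [d2 [P2 H2]].
  { intros s; destruct (N s) as [e [He Hs]]; exists e; split; [assumption|].
    intros d Hd; specialize (Hs d Hd); split; intros; lra. }
  destruct (count_germ (fun d s => 0 < t - d - s < c /\ dyadic c (t - d - s))
    (fun d s => 0 < t - s <= c /\ dyadic c (t - d - s)) L) as [d3 [P3 H3]].
  { intros s; destruct (N s) as [e [He Hs]]; exists e; split; [assumption|].
    intros d Hd; specialize (Hs d Hd); split; intros [? ?]; (split; [lra|assumption]). }
  exists (Rmin d1 (Rmin d2 d3)); split.
  - repeat apply Rmin_pos; assumption.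
  - intros d Hd; pose proof (Rmin_l d1 (Rmin d2 d3)); pose proof (Rmin_r d1 (Rmin d2 d3)).
    pose proof (Rmin_l d2 d3); pose proof (Rmin_r d2 d3).
    unfold stack; rewrite H1, H2, H3 by lra; split; reflexivity.
Qed.

Lemma infimum (B : R -> Prop) m :
  (exists t, B t) -> (forall t, B t -> m <= t) ->
  exists p, (forall t, B t -> p <= t) /\
    forall del, 0 < del -> exists t, B t /\ p <= t < p + del.
Proof.
  intros [t0 H0] Hm.
  (* [completeness] yields suprema, so the set is reflected in 0. *)
  destruct (completeness (fun u => B (- u))) as [u [Hu1 Hu2]].
  - exists (- m); intros v Hv; specialize (Hm _ Hv); lra.
  - exists (- t0); rewrite Ropp_involutive; assumption.
  - exists (- u); split.
    + intros t Ht; specialize (Hu1 (- t)); simpl in Hu1.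
      rewrite Ropp_involutive in Hu1; specialize (Hu1 Ht); lra.
    + intros del Hdel; apply NNPP; intros N.
      assert (u <= u - del); [|lra].
      apply Hu2; intros v Hv; apply Rnot_lt_le; intros Hlt.
      apply N; exists (- v); split; [assumption|].
      specialize (Hu1 v Hv); lra.
Qed.

(** * Overlapping translates when the value 4 and all values above 6 are excluded *)

Section Overlap.
Variables (c T : R) (L : list R).
Hypothesis c_pos : 0 < c.
Hypothesis stack_neg : forall t, t < 0 -> stack c L t = 0%nat.
Hypothesis stack_beyond : forall t, T < t -> stack c L t = 0%nat.
Hypothesis stack_hit : forall t, 0 <= t <= T -> (1 <= stack c L t)%nat.
Hypothesis stack_origin : stack c L 0 = 1%nat.
Hypothesis stack_not_4 : forall t, stack c L t <> 4%nat.
Hypothesis stack_le_6 : forall t, (stack c L t <= 6)%nat.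

(** Translates [s + [0, c]] are sorted by whether [p] is their left end, right end or an interior
    point. Those of the first two kinds are always in the class of [p], as 0 and [c] are dyadic
    multiples of [c]; only the third kind needs a separate class count. *)
Let starting p := count (fun s => s = p)%R L.
Let ending p := count (fun s => p - s = c)%R L.
Let through p := count (fun s => 0 < p - s < c)%R L.
Let through_class p := count (fun s => 0 < p - s < c /\ dyadic c (p - s))%R L.

Lemma right_cover p : count (fun s => 0 <= p - s < c)%R L = (starting p + through p)%nat.
Proof. apply count_split; intros; lra. Qed.

Lemma left_cover p : count (fun s => 0 < p - s <= c)%R L = (ending p + through p)%nat.
Proof. apply count_split; intros; lra. Qed.

Lemma stack_at p :
  stack c L p = (starting p + ending p + through p + through_class p)%nat.
Proof.
  unfold stack; fold (through_class p).
  rewrite (count_split (fun s => 0 <= p - s < c) (fun s => p - s = c)) by (intros; lra).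
  rewrite right_cover; unfold ending; lia.
Qed.

Lemma right_class p d : dyadic c d ->
  count (fun s => 0 <= p - s < c /\ dyadic c (p + d - s))%R L
  = (starting p + through_class p)%nat.
Proof.
  intros Hd; apply count_split; [|intros; lra].
  intros s; replace (p + d - s) with (p - s + d) by ring.
  rewrite dyadic_shift by assumption; split.
  - intros [H1 H2]; destruct (Req_dec s p); [auto|right; split; [lra|assumption]].
  - intros [->|[H1 H2]]; [|split; [lra|assumption]].
    split; [lra|]; replace (p - p) with 0 by ring; apply dyadic_0.
Qed.

Lemma left_class p d : dyadic c d ->
  count (fun s => 0 < p - s <= c /\ dyadic c (p - d - s))%R L
  = (ending p + through_class p)%nat.
Proof.
  intros Hd; apply count_split; [|intros; lra].
  intros s; replace (p - d - s) with (p - s + - d) by ring.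
  rewrite dyadic_shift by (apply dyadic_opp; assumption); split.
  - intros [H1 H2]; destruct (Req_dec (p - s) c); [auto|right; split; [lra|assumption]].
  - intros [E|[H1 H2]]; [|split; [lra|assumption]].
    split; [lra|]; rewrite E; apply dyadic_self.
Qed.

(** A shift avoiding the finitely many cosets involved removes every dyadic contribution. *)
Lemma right_values p : exists d, 0 < d /\
  stack c L (p + d) = (starting p + through p)%nat.
Proof.
  destruct (stack_right c L p c_pos) as [del [Hdel H]].
  destruct (avoid_cosets c p del L c_pos Hdel) as [d [Hd A]].
  exists d; split; [lra|]; destruct (H d Hd) as [_ ->]; rewrite right_cover.
  enough (count (fun s => 0 <= p - s < c /\ dyadic c (p + d - s))%R L = 0%nat) by lia.
  destruct (Nat.eq_dec (count (fun s => 0 <= p - s < c /\ dyadic c (p + d - s))%R L) 0)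
    as [E|E]; [exact E|exfalso].
  destruct (count_ex _ L (proj1 (Nat.neq_0_lt_0 _) E)) as [s [Hs [_ Ds]]].
  exact (A s Hs Ds).
Qed.

(** A dyadic shift keeps [p + d] in the class of [p]. *)
Lemma right_class_value p : exists d, 0 < d /\ stack c L (p + d)
  = (starting p + through p + (starting p + through_class p))%nat.
Proof.
  destruct (stack_right c L p c_pos) as [del [Hdel H]].
  destruct (dyadic_dense c 0 del c_pos Hdel) as [d [Hd Dd]].
  rewrite Rplus_0_l in Dd.
  exists d; split; [lra|]; destruct (H d Hd) as [_ ->].
  rewrite right_cover, right_class by assumption; reflexivity.
Qed.

Lemma left_class_value p : exists d, 0 < d /\ stack c L (p - d)
  = (ending p + through p + (ending p + through_class p))%nat.
Proof.
  destruct (stack_left c L p c_pos) as [del [Hdel H]].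
  destruct (dyadic_dense c 0 del c_pos Hdel) as [d [Hd Dd]].
  rewrite Rplus_0_l in Dd.
  exists d; split; [lra|]; destruct (H d Hd) as [_ ->].
  rewrite left_cover, left_class by assumption; reflexivity.
Qed.

Lemma through_class_le p : (through_class p <= through p)%nat.
Proof. apply count_le; tauto. Qed.

(** Three intervals over the right germ of [p], exactly two of them in the class of [p]: the third
    class is then a singleton and its points near [p] have value 3 + 1. *)
Lemma right_three p : (starting p + through p = 3)%nat ->
  (starting p + through_class p <> 2)%nat.
Proof.
  intros H3 H2.
  pose proof (right_cover p) as C.
  assert (Sp : count (fun s => 0 <= p - s < c)%R L
    = (count (fun s => 0 <= p - s < c /\ dyadic c (p + 0 - s))%R L
       + count (fun s => 0 <= p - s < c /\ ~ dyadic c (p + 0 - s))%R L)%nat).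
  { apply count_split; intros s; [|tauto].
    destruct (classic (dyadic c (p + 0 - s))); tauto. }
  rewrite right_class in Sp by apply dyadic_0.
  destruct (count_ex (fun s => 0 <= p - s < c /\ ~ dyadic c (p + 0 - s)) L ltac:(lia))
    as [s0 [I0 [J0 N0]]].
  rewrite Rplus_0_r in N0.
  destruct (stack_right c L p c_pos) as [del [Hdel H]].
  destruct (dyadic_dense c (p - s0) del c_pos Hdel) as [d [Hd Dd]].
  destruct (H d Hd) as [_ V].
  set (K := fun s => 0 <= p - s < c /\ dyadic c (p + d - s)) in V.
  assert (K1 : (1 <= count K L)%nat).
  { apply (count_pos K s0 L I0); split; [exact J0|].
    replace (p + d - s0) with (p - s0 + d) by ring; exact Dd. }
  assert (K2 : (count K L <= count (fun s => 0 <= p - s < c /\ ~ dyadic c (p + 0 - s))%R L)%nat).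
  { apply count_le; intros s [Hs Ds]; split; [exact Hs|]; intros Ds'; apply N0.
    replace (p - s0) with ((p - s0 + d) - (p + d - s) + (p + 0 - s)) by ring.
    apply dyadic_add; [apply dyadic_sub|]; assumption. }
  apply (stack_not_4 (p + d)); lia.
Qed.

Lemma left_cover_pos p : 0 < p -> p <= T -> (1 <= ending p + through p)%nat.
Proof.
  intros H0 HS.
  destruct (stack_left c L p c_pos) as [del [Hdel H]].
  set (d := Rmin del p / 2).
  assert (0 < Rmin del p) by (apply Rmin_pos; assumption).
  pose proof (Rmin_l del p); pose proof (Rmin_r del p).
  destruct (H d ltac:(unfold d; lra)) as [_ V].
  specialize (stack_hit (p - d) ltac:(unfold d; lra)).
  rewrite left_cover in V.
  (* With no translate over the left germ the class count would vanish too, and the representable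
     target [p - d] would have value 0. *)
  assert (count (fun s => 0 < p - s <= c /\ dyadic c (p - d - s))%R L <= ending p + through p)%nat.
  { rewrite <- left_cover; apply count_le; tauto. }
  lia.
Qed.

(** Let n and n' count the translates s + [0, c] covering the left and right germs of [p], and n_p,
    n'_p those in the class of [p]. Near [p] the values n', n' + n'_p and n + n_p occur, and none
    is 4 or exceeds 6. As n' > n, some translate starts at [p], so n'_p > 0 and n' is 3 or 5. If
    n' = 3, then n'_p = 3 by [right_three], and n = 1 gives value 4 at [p], n = 2 gives n_p = 2 and
    n + n_p = 4. If n' = 5, then n'_p = 1, so n >= 4. *)
Lemma first_crowding p :
  (ending p + through p <= 2)%nat -> (starting p + through p <= 2)%nat.
Proof.
  intros Hl; apply Nat.nlt_ge; intros Hr.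
  destruct (right_values p) as [d0 [Hd0 V0]].
  pose proof (stack_not_4 (p + d0)) as A0.
  assert (HS : p <= T).
  { apply Rnot_lt_le; intros HS; rewrite stack_beyond in V0 by lra; lia. }
  destruct (right_class_value p) as [d1 [_ V1]].
  pose proof (stack_not_4 (p + d1)) as A1; pose proof (stack_le_6 (p + d1)) as B1.
  destruct (left_class_value p) as [d2 [_ V2]].
  pose proof (stack_not_4 (p - d2)) as A2.
  pose proof (stack_at p) as V3; pose proof (stack_not_4 p) as A3.
  pose proof (through_class_le p) as Hc; pose proof (right_three p) as R3.
  (* A crowded right germ makes the value at [p] at least 3, which rules out [p <= 0]. *)
  destruct (Rtotal_order p 0) as [Hn|[->|Hp]].
  - rewrite stack_neg in V3 by assumption; lia.
  - rewrite stack_origin in V3; lia.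
  - pose proof (left_cover_pos p Hp HS); lia.
Qed.

(** Let [p] be the infimum of the crowded points. The left germ of [p] is not crowded, so by
    [first_crowding] neither is the right one; yet some crowded point is [p] itself or so close on
    its right that the counts agree. *)
Lemma right_cover_le_2 t : (starting t + through t <= 2)%nat.
Proof.
  apply Nat.nlt_ge; intros Ht.
  destruct (infimum (fun t => (2 < starting t + through t)%nat) 0) as [p [Hp1 Hp2]].
  - exists t; exact Ht.
  - intros u Hu; apply Rnot_lt_le; intros Hneg.
    pose proof (stack_at u) as E; rewrite stack_neg in E by assumption; lia.
  - assert (Hl : (ending p + through p <= 2)%nat).
    { destruct (stack_left c L p c_pos) as [del [Hdel H]].
      destruct (H (del / 2) ltac:(lra)) as [E _].
      rewrite left_cover, right_cover in E; rewrite <- E.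
      apply Nat.nlt_ge; intros Hb; specialize (Hp1 _ Hb); lra. }
    pose proof (first_crowding p Hl) as Hr.
    destruct (stack_right c L p c_pos) as [del [Hdel H]].
    destruct (Hp2 del Hdel) as [u [Hu [[Hlt| ->] Hud]]]; [|lia].
    destruct (H (u - p) ltac:(lra)) as [E _].
    replace (p + (u - p)) with u in E by ring.
    rewrite !right_cover in E; lia.
Qed.

Lemma left_cover_le_2 t : (ending t + through t <= 2)%nat.
Proof.
  destruct (stack_left c L t c_pos) as [del [Hdel H]].
  destruct (H (del / 2) ltac:(lra)) as [E _].
  rewrite left_cover, right_cover in E; rewrite <- E; apply right_cover_le_2.
Qed.

(** As 4 is excluded, two translates over one germ of [t] are never both in the class of [t]. So if
    two pass through [t], at most one is in the class; if one passes while another starts or ends,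
    the passing one is not; if none passes, at most one starts and one ends. *)
Lemma stack_le_3 t : (stack c L t <= 3)%nat.
Proof.
  destruct (right_class_value t) as [d1 [_ V1]]; pose proof (stack_not_4 (t + d1)).
  destruct (left_class_value t) as [d2 [_ V2]]; pose proof (stack_not_4 (t - d2)).
  pose proof (stack_at t); pose proof (through_class_le t).
  pose proof (right_cover_le_2 t); pose proof (left_cover_le_2 t).
  lia.
Qed.

End Overlap.

(** * Digit sequences and cardinalities of sets of them *)

Definition shift (e : nat -> bool) : nat -> bool := fun k => e (S k).

Definition scons (b : bool) (e : nat -> bool) : nat -> bool :=
  fun k => match k with O => b | S k' => e k' end.

Lemma scons_shift e : scons (e 0%nat) (shift e) = e.
Proof. apply functional_extensionality; intros [|k]; reflexivity. Qed.

Lemma scons_inj b e e' : scons b e = scons b e' -> e = e'.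
Proof.
  intros H; apply functional_extensionality; intros k.
  exact (f_equal (fun g => g (S k)) H).
Qed.

Fixpoint prefix (e : nat -> bool) (k : nat) : list bool :=
  match k with O => nil | S k' => e 0%nat :: prefix (shift e) k' end.

Lemma prefix_length e k : length (prefix e k) = k.
Proof. revert e; induction k; intros e; simpl; auto. Qed.

Lemma prefix_snoc e k : prefix e (S k) = prefix e k ++ e k :: nil.
Proof.
  revert e; induction k as [|k IH]; intros e; [reflexivity|].
  change (prefix e (S (S k))) with (e 0%nat :: prefix (shift e) (S k)).
  rewrite IH; reflexivity.
Qed.

Lemma prefix_nth e k (q : list bool) :
  (k <= length q)%nat -> (forall i, (i < k)%nat -> e i = nth i q false) ->
  prefix e k = firstn k q.
Proof.
  revert e q; induction k as [|k IH]; intros e [|b q] Hk H; simpl in *; try reflexivity; [lia|].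
  rewrite (H 0%nat) by lia; f_equal; apply IH; [lia|].
  intros i Hi; apply (H (S i)); lia.
Qed.

(** Schroeder--Bernstein, where one of the two injections is an inclusion. *)
Lemma card_is_Cont (P : (nat -> bool) -> Prop) h :
  (forall a b : nat -> bool, h a = h b -> a = b) -> (forall a, P (h a)) -> card_is P Cont.
Proof.
  intros Hi HP.
  (* As in Hilbert's hotel, [h] moves the orbits of the points outside [P] one step into [P]; all
     other points stay fixed. *)
  set (orbit := fun e => exists n y, ~ P y /\ e = Nat.iter n h y).
  exists (fun e => if excluded_middle_informative (orbit e) then h e else e); split.
  - intros a b; destruct (excluded_middle_informative (orbit a)) as [Ha|Ha];
    destruct (excluded_middle_informative (orbit b)) as [Hb|Hb]; intros E.
    + auto.
    + destruct Ha as [n [y [Hy ->]]]; exfalso; apply Hb; exists (S n), y; auto.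
    + destruct Hb as [n [y [Hy ->]]]; exfalso; apply Ha; exists (S n), y; auto.
    + exact E.
  - intros e; split.
    + intros He; destruct (classic (orbit e)) as [O|O].
      * destruct O as [[|n] [y [Hy ->]]]; [simpl in He; contradiction|].
        exists (Nat.iter n h y).
        destruct (excluded_middle_informative (orbit (Nat.iter n h y))) as [|N];
          [reflexivity|].
        exfalso; apply N; exists n, y; auto.
      * exists e; destruct (excluded_middle_informative (orbit e)); tauto.
    + intros [a <-]; destruct (excluded_middle_informative (orbit a)) as [O|O]; [apply HP|].
      apply NNPP; intros N; apply O; exists 0%nat, a; auto.
Qed.

Lemma card_is_unique (P : (nat -> bool) -> Prop) m n :
  card_is P (Fin m) -> card_is P (Fin n) -> m = n.
Proof.
  intros [l [Hl [<- El]]] [l' [Hl' [<- El']]].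
  apply Nat.le_antisymm; apply NoDup_incl_length; try assumption.
  - intros e He; apply El', El, He.
  - intros e He; apply El, El', He.
Qed.

Lemma card_is_0 (P : (nat -> bool) -> Prop) : (forall e, ~ P e) -> card_is P (Fin 0).
Proof.
  intros H; exists nil; repeat split; [constructor|intros; exfalso; firstorder|simpl; tauto].
Qed.

Lemma card_is_1 (P : (nat -> bool) -> Prop) e0 :
  P e0 -> (forall e, P e -> e = e0) -> card_is P (Fin 1).
Proof.
  intros H0 H; exists (e0 :: nil); repeat split.
  - constructor; [simpl; tauto|constructor].
  - intros He; left; symmetry; auto.
  - intros [<-|[]]; exact H0.
Qed.

Lemma card_is_scons (P P0 P1 : (nat -> bool) -> Prop) a b :
  (forall e, P e <-> (if e 0%nat then P1 else P0) (shift e)) ->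
  card_is P0 (Fin a) -> card_is P1 (Fin b) -> card_is P (Fin (a + b)).
Proof.
  intros H [l0 [N0 [<- E0]]] [l1 [N1 [<- E1]]].
  exists (map (scons false) l0 ++ map (scons true) l1); repeat split.
  - apply NoDup_app.
    + apply Injective_map_NoDup; [intros ? ?; apply scons_inj|assumption].
    + apply Injective_map_NoDup; [intros ? ?; apply scons_inj|assumption].
    + intros e; rewrite !in_map_iff; intros [e0 [<- _]] [e1 [E _]].
      discriminate (f_equal (fun g => g 0%nat) E).
  - rewrite length_app, !length_map; reflexivity.
  - rewrite H, in_app_iff, !in_map_iff; intros He; rewrite <- (scons_shift e).
    destruct (e 0%nat); [right|left]; exists (shift e); (split; [reflexivity|]).
    + apply E1; exact He.
    + apply E0; exact He.
  - rewrite H, in_app_iff, !in_map_iff.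
    intros [[e' [<- He']]|[e' [<- He']]]; simpl.
    + apply E0; exact He'.
    + apply E1; exact He'.
Qed.

(** * The tree of representations *)

Section Tree.
(** The hypotheses below make [r n] the sum of the terms with index at least [n]. *)
Variables x r : nat -> R.
Hypothesis x_pos : forall n, 0 < x n.
Hypothesis r_step : forall n, r n = x n + r (S n).
Hypothesis r_nonneg : forall n, 0 <= r n.
Hypothesis r_small : forall eps, 0 < eps -> exists N, forall n, (N <= n)%nat -> r n < eps.

Lemma r_pos n : 0 < r n.
Proof. rewrite r_step; pose proof (x_pos n); pose proof (r_nonneg (S n)); lra. Qed.

(** A node is a finite word of digits; [n] is the index of the term governed by its first digit. *)
Fixpoint node_sum (n : nat) (q : list bool) : R :=
  match q with
  | nil => 0
  | b :: q' => (if b then x n else 0) + node_sum (S n) q'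
  end.

Lemma node_sum_app n q q' :
  node_sum n (q ++ q') = node_sum n q + node_sum (n + length q) q'.
Proof.
  revert n; induction q as [|b q IH]; intros n; simpl.
  - rewrite Nat.add_0_r; ring.
  - rewrite IH, Nat.add_succ_r; simpl; ring.
Qed.

Lemma node_sum_bounds n q : 0 <= node_sum n q <= r n - r (n + length q).
Proof.
  revert n; induction q as [|b q IH]; intros n; simpl.
  - rewrite Nat.add_0_r; lra.
  - specialize (IH (S n)); rewrite Nat.add_succ_r; simpl in IH.
    pose proof (x_pos n); pose proof (r_step n); destruct b; lra.
Qed.

(** [t] can still be reached from the node [q], whose remaining terms add up to [r (n + length q)]. *)
Definition live (n : nat) (t : R) (q : list bool) : Prop :=
  0 <= t - node_sum n q <= r (n + length q).

Lemma live_app n t q q' : live n t (q ++ q') -> live n t q.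
Proof.
  unfold live; rewrite node_sum_app, length_app, Nat.add_assoc.
  pose proof (node_sum_bounds (n + length q) q'); lra.
Qed.

(** An infinite branch of live nodes. As the tails tend to 0, this says without a limit that the
    terms from index [n] on, selected by [e], sum to [t]. *)
Definition rep (n : nat) (t : R) (e : nat -> bool) : Prop :=
  forall k, live n t (prefix e k).

Lemma rep_bounds n t e : rep n t e -> 0 <= t <= r n.
Proof.
  intros H; specialize (H 0%nat); unfold live in H; simpl in H.
  rewrite Nat.add_0_r in H; lra.
Qed.

Lemma rep_step n t e :
  rep n t e <-> (if e 0%nat then rep (S n) (t - x n) else rep (S n) t) (shift e).
Proof.
  assert (A : forall k, live n t (prefix e (S k)) <->
    live (S n) (if e 0%nat then t - x n else t) (prefix (shift e) k)).
  { intros k; unfold live; simpl; rewrite prefix_length, Nat.add_succ_r.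
    destruct (e 0%nat); split; intros H; lra. }
  assert (B : rep n t e <-> rep (S n) (if e 0%nat then t - x n else t) (shift e)).
  { split; intros H.
    - intros k; apply A, H.
    (* The root is no child's node; it is live because the target left after the first digit lies in
       [[0, r (S n)]]. *)
    - intros [|k]; [|apply A, H].
      apply rep_bounds in H; unfold live; simpl; rewrite Nat.add_0_r.
      pose proof (x_pos n); pose proof (r_step n); destruct (e 0%nat); lra. }
  rewrite B; destruct (e 0%nat); reflexivity.
Qed.

Lemma card_rep_step n t a b :
  card_is (rep (S n) t) (Fin a) -> card_is (rep (S n) (t - x n)) (Fin b) ->
  card_is (rep n t) (Fin (a + b)).
Proof.
  apply card_is_scons; intros e; rewrite rep_step; destruct (e 0%nat); reflexivity.
Qed.

Lemma card_rep_out n t : ~ 0 <= t <= r n -> card_is (rep n t) (Fin 0).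
Proof. intros H; apply card_is_0; intros e He; exact (H (rep_bounds _ _ _ He)). Qed.

(** Taking a term would leave a negative target, so every digit is [false]. *)
Lemma card_rep_0 n : card_is (rep n 0) (Fin 1).
Proof.
  assert (A : forall n e, rep n 0 e -> e 0%nat = false /\ rep (S n) 0 (shift e)).
  { intros m e He; apply rep_step in He; destruct (e 0%nat); [|auto].
    apply rep_bounds in He; pose proof (x_pos m); lra. }
  assert (Z : forall k n, node_sum n (prefix (fun _ => false) k) = 0).
  { induction k as [|k IH]; intros m; simpl; [reflexivity|].
    change (shift (fun _ => false)) with (fun _ : nat => false); rewrite IH; ring. }
  apply card_is_1 with (fun _ => false).
  - intros k; unfold live; rewrite Z; specialize (r_nonneg (n + length (prefix (fun _ => false) k))); lra.
  - intros e He; apply functional_extensionality; intros k.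
    revert n e He; induction k as [|k IH]; intros n e He; destruct (A n e He) as [E0 E1].
    + exact E0.
    + exact (IH (S n) (shift e) E1).
Qed.

(** Omitting a term would leave more than the later terms can supply, so every digit is [true]. *)
Lemma card_rep_full n : card_is (rep n (r n)) (Fin 1).
Proof.
  assert (A : forall n e, rep n (r n) e -> e 0%nat = true /\ rep (S n) (r (S n)) (shift e)).
  { intros m e He; apply rep_step in He; pose proof (r_step m) as Rm; destruct (e 0%nat).
    - replace (r m - x m) with (r (S m)) in He by lra; auto.
    - apply rep_bounds in He; pose proof (x_pos m); lra. }
  assert (Z : forall k n, node_sum n (prefix (fun _ => true) k) = r n - r (n + k)).
  { induction k as [|k IH]; intros m; simpl.
    - rewrite Nat.add_0_r; ring.
    - change (shift (fun _ => true)) with (fun _ : nat => true).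
      rewrite IH, Nat.add_succ_r, (r_step m); simpl; ring. }
  apply card_is_1 with (fun _ => true).
  - intros k; unfold live; rewrite Z, prefix_length.
    specialize (r_nonneg (n + k)); lra.
  - intros e He; apply functional_extensionality; intros k.
    revert n e He; induction k as [|k IH]; intros n e He; destruct (A n e He) as [E0 E1].
    + exact E0.
    + exact (IH (S n) (shift e) E1).
Qed.

(** * Greedy expansions under Kakeya's condition *)

Hypothesis kakeya : forall n, x n <= r (S n).

Definition greedy_digit (n : nat) (t : R) : bool := if Rle_dec (x n) t then true else false.

Fixpoint greedy (n : nat) (t : R) (k : nat) : bool :=
  match k with
  | O => greedy_digit n t
  | S k' => greedy (S n) (if greedy_digit n t then t - x n else t) k'
  end.

(** A target below [x n] is at most [r (S n)] by [kakeya], and from any other the subtraction of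
    [x n] leaves at most [r (S n)]. *)
Lemma greedy_rep n t : 0 <= t <= r n -> rep n t (greedy n t).
Proof.
  intros Ht k; revert n t Ht; induction k as [|k IH]; intros n t Ht.
  - unfold live; simpl; rewrite Nat.add_0_r; lra.
  - set (u := if greedy_digit n t then t - x n else t).
    assert (Hu : 0 <= u <= r (S n)).
    { pose proof (kakeya n); pose proof (r_step n); unfold u, greedy_digit.
      destruct (Rle_dec (x n) t); lra. }
    specialize (IH (S n) u Hu); unfold live in *; simpl.
    change (shift (greedy n t)) with (greedy (S n) u).
    rewrite Nat.add_succ_r; simpl in IH.
    unfold u in IH |- *; destruct (greedy_digit n t); lra.
Qed.

(** * Continuum many representations from infinitely many strict inequalities *)

Section Branching.
Hypothesis slack : forall n, exists m, (n <= m)%nat /\ x m < r (S m).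

(** One extension [q'] serves the whole interval, so splitting survives further shrinking. *)
Definition splits_on (a b : R) (q : list bool) : Prop :=
  exists q', forall t, a <= t <= b ->
    live 0 t (q ++ q' ++ false :: nil) /\ live 0 t (q ++ q' ++ true :: nil).

(** The greedy path of the midpoint is followed to a level [m] with strict inequality and
    [r m < (b - a) / 2]. From its node, with sum [p], both digits keep the targets in
    [[p + x m, p + r (S m)]] live, and this interval lies within [(a, b)]. *)
Lemma live_split q a b :
  a < b -> (forall t, a < t < b -> live 0 t q) ->
  exists a' b', a < a' /\ a' < b' /\ b' < b /\ splits_on a' b' q.
Proof.
  intros Hab Hq.
  set (u := (a + b) / 2); set (n := length q).
  assert (Hu : live 0 u q) by (apply Hq; unfold u; lra).
  destruct (r_small ((b - a) / 2) ltac:(lra)) as [N HN].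
  destruct (slack (max N n)) as [m [Hm Hslack]].
  specialize (HN m ltac:(lia)).
  set (q' := prefix (greedy n (u - node_sum 0 q)) (m - n)).
  assert (Hq' : live 0 u (q ++ q')).
  { unfold live in Hu; simpl in Hu; fold n in Hu.
    pose proof (greedy_rep n (u - node_sum 0 q) Hu (m - n)%nat) as G.
    fold q' in G; unfold live in *.
    rewrite node_sum_app, length_app, Nat.add_assoc; simpl; fold n; lra. }
  assert (Lq' : length (q ++ q') = m).
  { rewrite length_app; unfold q'; rewrite prefix_length; fold n; lia. }
  set (p := node_sum 0 (q ++ q')).
  unfold live in Hq'; fold p in Hq'; rewrite Lq' in Hq'; simpl in Hq'.
  pose proof (x_pos m); pose proof (r_step m).
  exists (p + x m), (p + r (S m)); unfold u in *; repeat split; try lra.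
  exists q'; intros t Ht; unfold live; rewrite !app_assoc.
  rewrite !(node_sum_app 0 (q ++ q')), !(length_app (q ++ q')), Lq'; fold p; simpl.
  rewrite Nat.add_1_r; lra.
Qed.

(** If some target in [(a, b)] is dead, so is an interval next to it, since the live targets of a
    node form a closed interval. *)
Lemma refine q a b : a < b -> exists a' b', a <= a' /\ a' < b' /\ b' <= b /\
  (splits_on a' b' q \/ forall t, a' <= t <= b' -> ~ live 0 t q).
Proof.
  intros Hab.
  destruct (classic (forall t, a < t < b -> live 0 t q)) as [H|H].
  - destruct (live_split q a b Hab H) as [a' [b' [? [? [? Hs]]]]].
    exists a', b'; repeat split; try lra; auto.
  - apply not_all_ex_not in H; destruct H as [t Ht].
    apply imply_to_and in Ht; destruct Ht as [Ht Hd]; unfold live in Hd.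
    set (p := node_sum 0 q) in *; set (w := r (0 + length q)) in *.
    destruct (Rlt_le_dec t p) as [H|H].
    + exists t, (Rmin ((t + p) / 2) b); pose proof (Rmin_l ((t + p) / 2) b).
      pose proof (Rmin_r ((t + p) / 2) b).
      repeat split; try lra; [apply Rmin_glb_lt; lra|right].
      intros v Hv; unfold live; fold p; lra.
    + exists (Rmax ((t + (p + w)) / 2) a), t; pose proof (Rmax_l ((t + (p + w)) / 2) a).
      pose proof (Rmax_r ((t + (p + w)) / 2) a).
      repeat split; try lra; [apply Rmax_lub_lt; lra|right].
      intros v Hv; unfold live; fold p; fold w; lra.
Qed.

(** Reading a positive number without its leading 1 enumerates all finite words, so the nodes are
    countable. *)
Fixpoint bits (p : positive) : list bool :=
  match p with
  | xH => nil
  | xO p' => false :: bits p'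
  | xI p' => true :: bits p'
  end.

Lemma bits_surjective q : exists i, bits (Pos.of_nat i) = q.
Proof.
  assert (A : exists p, bits p = q).
  { induction q as [|[|] q [p <-]]; [exists xH|exists (xI p)|exists (xO p)]; reflexivity. }
  destruct A as [p <-]; exists (Pos.to_nat p); rewrite Pos2Nat.id; reflexivity.
Qed.

Lemma nested_point (a b : nat -> R) :
  (forall i, a i < b i) -> (forall i, a i <= a (S i)) -> (forall i, b (S i) <= b i) ->
  exists t, forall i, a i <= t <= b i.
Proof.
  intros Hab Ha Hb.
  assert (Ma : forall i k, a i <= a (i + k)%nat).
  { intros i k; induction k; [rewrite Nat.add_0_r; lra|].
    rewrite Nat.add_succ_r; specialize (Ha (i + k)%nat); lra. }
  assert (Mb : forall i k, b (i + k)%nat <= b i).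
  { intros i k; induction k; [rewrite Nat.add_0_r; lra|].
    rewrite Nat.add_succ_r; specialize (Hb (i + k)%nat); lra. }
  assert (C : forall i j, a i <= b j).
  { intros i j; specialize (Ma i j); specialize (Mb j i); specialize (Hab (i + j)%nat).
    rewrite (Nat.add_comm j i) in Mb; lra. }
  destruct (completeness (fun u => exists i, u = a i)) as [t [H1 H2]].
  - exists (b 0%nat); intros u [i ->]; apply C.
  - exists (a 0%nat), 0%nat; reflexivity.
  - exists t; intros i; split; [apply H1; exists i; reflexivity|].
    apply H2; intros u [j ->]; apply C.
Qed.

(** A Baire category argument: running through all nodes, shrink the interval until the node either
    dies or splits. *)
Lemma perfect_point : exists t, 0 <= t <= r 0 /\ forall q, live 0 t q ->
  exists q', live 0 t (q ++ q' ++ false :: nil) /\ live 0 t (q ++ q' ++ true :: nil).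
Proof.
  set (interval := {ab : R * R | fst ab < snd ab}).
  assert (A : forall q, exists step : interval -> interval, forall I,
    fst (proj1_sig I) <= fst (proj1_sig (step I)) /\
    snd (proj1_sig (step I)) <= snd (proj1_sig I) /\
    (splits_on (fst (proj1_sig (step I))) (snd (proj1_sig (step I))) q \/
     forall t, fst (proj1_sig (step I)) <= t <= snd (proj1_sig (step I)) -> ~ live 0 t q)).
  { intros q; apply (choice (fun I J : interval =>
      fst (proj1_sig I) <= fst (proj1_sig J) /\ snd (proj1_sig J) <= snd (proj1_sig I) /\
      (splits_on (fst (proj1_sig J)) (snd (proj1_sig J)) q \/
       forall t, fst (proj1_sig J) <= t <= snd (proj1_sig J) -> ~ live 0 t q))).
    intros [[a b] Hab]; destruct (refine q a b Hab) as [a' [b' [? [Hab' [? ?]]]]].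
    exists (exist (fun ab : R * R => fst ab < snd ab) (a', b') Hab'); simpl; auto. }
  apply choice in A; destruct A as [step Hstep].
  set (I := nat_rect (fun _ => interval)
    (exist (fun ab : R * R => fst ab < snd ab) (0, r 0) (r_pos 0))
    (fun i J => step (bits (Pos.of_nat i)) J)).
  destruct (nested_point (fun i => fst (proj1_sig (I i))) (fun i => snd (proj1_sig (I i))))
    as [t Ht].
  - intros i; exact (proj2_sig (I i)).
  - intros i; apply (Hstep (bits (Pos.of_nat i)) (I i)).
  - intros i; apply (Hstep (bits (Pos.of_nat i)) (I i)).
  - exists t; split; [exact (Ht 0%nat)|].
    intros q Hq; destruct (bits_surjective q) as [i <-].
    destruct (Hstep (bits (Pos.of_nat i)) (I i)) as [_ [_ [[q' Hq']|Hd]]].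
    + exists q'; exact (Hq' t (Ht (S i))).
    + exfalso; exact (Hd t (Ht (S i)) Hq).
Qed.

(** A Cantor scheme at a perfect point: the digits of [al] choose a side at successive splittings,
    which injects all digit sequences into the representations. *)
Lemma card_rep_Cont : exists t, 0 <= t <= r 0 /\ card_is (rep 0 t) Cont.
Proof.
  destruct perfect_point as [t [Ht H]]; exists t; split; [exact Ht|].
  assert (A : exists ext, forall q, live 0 t q -> forall b : bool, live 0 t (q ++ ext q ++ b :: nil)).
  { apply (choice (fun q q' => live 0 t q -> forall b : bool, live 0 t (q ++ q' ++ b :: nil))).
    intros q; destruct (classic (live 0 t q)) as [Hq|Hq].
    - destruct (H q Hq) as [q' [H0 H1]]; exists q'; intros _ [|]; assumption.
    - exists nil; tauto. }
  destruct A as [ext Hext].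
  set (node := fun (al : nat -> bool) => nat_rect (fun _ => list bool) nil
    (fun k q => q ++ ext q ++ al k :: nil)).
  assert (Nlive : forall al k, live 0 t (node al k)).
  { intros al k; induction k as [|k IH]; [unfold live; simpl; lra|apply Hext, IH]. }
  assert (Nlen : forall al k, (k <= length (node al k))%nat).
  { intros al k; induction k as [|k IH]; simpl; [lia|].
    rewrite !length_app; simpl; fold (node al k); lia. }
  assert (Nnth : forall al i k j, (i < length (node al k))%nat ->
    nth i (node al (k + j)%nat) false = nth i (node al k) false).
  { intros al i k j Hi; induction j as [|j IH]; [rewrite Nat.add_0_r; reflexivity|].
    rewrite Nat.add_succ_r; simpl; fold (node al (k + j)%nat).
    assert (M : (length (node al k) <= length (node al (k + j)%nat))%nat).
    { clear; induction j as [|j IH]; [rewrite Nat.add_0_r; lia|].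
      rewrite Nat.add_succ_r; simpl; rewrite length_app; fold (node al (k + j)%nat); lia. }
    rewrite app_nth1 by lia; exact IH. }
  (* The node at stage [S i] has length at least [S i], so its digit [i] is genuine and not the
     default [false]. *)
  set (code := fun al i => nth i (node al (S i)) false).
  assert (Hcode : forall al i k, (i < length (node al k))%nat -> code al i = nth i (node al k) false).
  { intros al i k Hi; unfold code.
    pose proof (Nlen al (S i)).
    rewrite <- (Nnth al i (S i) k) by lia.
    rewrite <- (Nnth al i k (S i)) by lia.
    rewrite Nat.add_comm; reflexivity. }
  apply card_is_Cont with code.
  - intros al be E.
    (* From a common node [q], the choice made at stage [k] is the digit right after
       [q ++ ext q]. *)
    assert (Q : forall k, node al k = node be k -> al k = be k).
    { intros k Ek; set (q := node al k) in *.
      pose proof (f_equal (fun g => g (length (q ++ ext q))) E) as D; simpl in D.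
      rewrite (Hcode al _ (S k)), (Hcode be _ (S k)) in D.
      - simpl in D; fold (node al k) (node be k) in D; rewrite <- Ek in D; fold q in D.
        rewrite !(app_assoc q), !app_nth2, !Nat.sub_diag in D by lia; exact D.
      - simpl; fold (node be k); rewrite <- Ek, !length_app; simpl; lia.
      - simpl; fold (node al k); fold q; rewrite !length_app; simpl; lia. }
    assert (Q' : forall k, node al k = node be k).
    { induction k as [|k IH]; [reflexivity|].
      simpl; fold (node al k) (node be k); rewrite <- IH, (Q k IH); reflexivity. }
    apply functional_extensionality; intros k; apply Q, Q'.
  - intros al k.
    rewrite (prefix_nth (code al) k (node al k)).
    + apply live_app with (skipn k (node al k)); rewrite firstn_skipn; apply Nlive.
    + apply Nlen.
    + intros i Hi; apply Hcode; pose proof (Nlen al k); lia.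
Qed.

End Branching.

(** * Eventual equality and binary expansions *)

Section Geometric_tail.
Variable n0 : nat.
Hypothesis tail_eq : forall n, (n0 <= n)%nat -> x n = r (S n).

Lemma tail_half n : (n0 <= n)%nat -> r (S n) = r n / 2.
Proof. intros H; pose proof (tail_eq n H); pose proof (r_step n); lra. Qed.

(** Halving [c] does not change [c Z[1/2]], so all levels of the tail share the same classes. *)
Lemma dyadic_tail n u : (n0 <= n)%nat -> dyadic (r (S n)) u <-> dyadic (r n) u.
Proof.
  intros H; rewrite (tail_half n H); split; intros [z [k ->]].
  - exists z, (S k); simpl; pose proof (pow2_pos k); field; lra.
  - exists (2 * z)%Z, k; rewrite mult_IZR; pose proof (pow2_pos k); field; lra.
Qed.

(** Passing to the next level halves [r n] and lowers the exponent [k] by one. The first digit is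
    forced unless [u = x n]; exponent 0 cannot occur strictly inside the interval. *)
Lemma card_rep_dyadic n u : (n0 <= n)%nat -> 0 < u < r n -> dyadic (r n) u ->
  card_is (rep n u) (Fin 2).
Proof.
  intros Hn Hu [z [k Hz]]; revert n u z Hn Hu Hz.
  induction k as [|k IH]; intros n u z Hn Hu Hz.
  - exfalso; simpl in Hz; pose proof (r_pos n).
    assert (E : u = IZR z * r n) by (rewrite Hz; field).
    assert (0 < IZR z) by (apply Rmult_lt_reg_r with (r n); lra).
    assert (IZR z < 1) by (apply Rmult_lt_reg_r with (r n); lra).
    apply lt_IZR in H0; apply (lt_IZR z 1) in H1; lia.
  - pose proof (tail_half n Hn) as Hh; pose proof (tail_eq n Hn) as Hx.
    pose proof (pow2_pos k); pose proof (r_pos (S n)).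
    assert (Eu : u = IZR z * r (S n) / 2 ^ k) by (rewrite Hz, Hh; simpl; field; lra).
    destruct (Rtotal_order u (x n)) as [L|[E|G]].
    + change 2%nat with (2 + 0)%nat; apply card_rep_step.
      * apply IH with z; [lia|lra|exact Eu].
      * apply card_rep_out; lra.
    (* As [x n = r (S n)], the target is either [x n] alone or the sum of all later terms. *)
    + change 2%nat with (1 + 1)%nat; apply card_rep_step.
      * rewrite E, Hx; apply card_rep_full.
      * rewrite E, Rminus_diag; apply card_rep_0.
    + change 2%nat with (0 + 2)%nat; apply card_rep_step.
      * apply card_rep_out; lra.
      * apply IH with (z - 2 ^ Z.of_nat k)%Z; [lia|lra|].
        rewrite Eu, Hx, minus_IZR, <- pow2_IZR; field; lra.
Qed.

Lemma card_rep_not_dyadic n u : (n0 <= n)%nat -> 0 <= u <= r n -> ~ dyadic (r n) u ->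
  card_is (rep n u) (Fin 1).
Proof.
  intros Hn Hu Hd; apply card_is_1 with (greedy n u); [apply greedy_rep; exact Hu|].
  intros e He; pose proof (greedy_rep n u Hu) as Hg; revert Hg; generalize (greedy n u) as g.
  intros g Hg; apply functional_extensionality; intros k; clear Hu.
  revert n u e g Hn Hd He Hg; induction k as [|k IH]; intros n u e g Hn Hd He Hg.
  all: apply rep_step in He; apply rep_step in Hg.
  (* Differing digits force both [u >= x n] and [u <= r (S n)]; these bounds coincide, making [u]
     dyadic. *)
  all: assert (E : e 0%nat = g 0%nat) by
    (destruct (e 0%nat), (g 0%nat); try reflexivity; exfalso; apply Hd;
     apply rep_bounds in He; apply rep_bounds in Hg; pose proof (tail_eq n Hn);
     apply dyadic_tail; [exact Hn| |exact Hn|];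
     (replace u with (r (S n)) by lra); apply dyadic_self).
  - exact E.
  - rewrite <- E in Hg.
    apply (IH (S n) (if e 0%nat then u - x n else u) (shift e) (shift g)).
    + lia.
    + intros D; apply Hd, (dyadic_tail n u Hn); destruct (e 0%nat); [|exact D].
      replace u with (u - x n + x n) by ring; apply dyadic_add; [exact D|].
      rewrite (tail_eq n Hn); apply dyadic_self.
    + destruct (e 0%nat); exact He.
    + destruct (e 0%nat); exact Hg.
Qed.

Lemma card_rep_tail u : card_is (rep n0 u) (Fin (stack (r n0) (0 :: nil) u)).
Proof.
  unfold stack; simpl; rewrite Rminus_0_r.
  pose proof (Nat.le_refl n0) as Hn; pose proof (r_pos n0).
  decide_counts; simpl.
  - apply card_rep_dyadic; tauto.
  - destruct (Req_dec u 0) as [->|]; [apply card_rep_0|].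
    destruct (Req_dec u (r n0)) as [->|]; [apply card_rep_full|].
    apply card_rep_not_dyadic; [exact Hn|lra|].
    intros D; apply n; split; [lra|exact D].
  - lra.
  - apply card_rep_out; assumption.
Qed.

(** Going down from [n0], each earlier term adjoins to the list its translate by that term. *)
Lemma card_rep_stack : exists L, forall t, card_is (rep 0 t) (Fin (stack (r n0) L t)).
Proof.
  assert (A : forall k n, (k + n = n0)%nat ->
    exists L, forall t, card_is (rep n t) (Fin (stack (r n0) L t))).
  { induction k as [|k IH]; intros n Hn.
    - simpl in Hn; subst n; exists (0 :: nil); exact card_rep_tail.
    - destruct (IH (S n) ltac:(lia)) as [L HL].
      exists (L ++ map (Rplus (x n)) L); intros t.
      replace (stack (r n0) (L ++ map (Rplus (x n)) L) t)
        with (stack (r n0) L t + stack (r n0) L (t - x n))%nat.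
      + apply card_rep_step; apply HL.
      + unfold stack; rewrite !count_app, !count_map.
        rewrite (count_ext (fun s => 0 <= t - (x n + s) <= r n0) (fun s => 0 <= t - x n - s <= r n0))
          by (intros s; replace (t - (x n + s)) with (t - x n - s) by ring; tauto).
        rewrite (count_ext (fun s => 0 < t - (x n + s) < r n0 /\ dyadic (r n0) (t - (x n + s)))
          (fun s => 0 < t - x n - s < r n0 /\ dyadic (r n0) (t - x n - s)))
          by (intros s; replace (t - (x n + s)) with (t - x n - s) by ring; tauto).
        lia. }
  destruct (A n0 0%nat ltac:(lia)) as [L HL]; exists L; exact HL.
Qed.

End Geometric_tail.

Lemma rep_dichotomy :
  (exists t, 0 <= t <= r 0 /\ card_is (rep 0 t) Cont) \/
  exists c L, 0 < c /\ forall t, card_is (rep 0 t) (Fin (stack c L t)).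
Proof.
  destruct (classic (forall n, exists m, (n <= m)%nat /\ x m < r (S m))) as [H|H].
  - left; apply card_rep_Cont; exact H.
  - right; apply not_all_ex_not in H; destruct H as [n0 H].
    destruct (card_rep_stack n0) as [L HL].
    + intros n Hn; apply Rle_antisym; [apply kakeya|].
      apply Rnot_lt_le; intros Hlt; apply H; exists n; auto.
    + exists (r n0), L; split; [apply r_pos|exact HL].
Qed.

End Tree.

(** * Unordered sums and invariance under permutation *)

Definition lsum (a : nat -> R) (l : list nat) : R := fold_right (fun i acc => a i + acc) 0 l.

Lemma lsum_app a l l' : lsum a (l ++ l') = lsum a l + lsum a l'.
Proof. induction l as [|i l IH]; simpl; [ring|rewrite IH; ring]. Qed.

Lemma lsum_map a (s : nat -> nat) l : lsum a (map s l) = lsum (fun i => a (s i)) l.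
Proof. induction l as [|i l IH]; simpl; [reflexivity|rewrite IH; reflexivity]. Qed.

Lemma lsum_incl a l l' :
  (forall i, 0 <= a i) -> NoDup l -> incl l l' -> lsum a l <= lsum a l'.
Proof.
  intros Ha; revert l'; induction l as [|i l IH]; intros l' Hl Hi; simpl.
  - clear Hi; induction l' as [|j l' IH']; simpl; [lra|specialize (Ha j); lra].
  - inversion Hl as [|? ? Hn Hd]; subst.
    destruct (in_split i l' (Hi i (in_eq i l))) as [l1 [l2 ->]].
    assert (lsum a l <= lsum a (l1 ++ l2)).
    { apply IH; [assumption|]; intros j Hj.
      specialize (Hi j (in_cons i j l Hj)); rewrite in_app_iff in *; simpl in Hi.
      destruct Hi as [?|[->|?]]; [auto|contradiction|auto]. }
    rewrite lsum_app in *; simpl; lra.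
Qed.

Lemma sum_f_R0_lsum a n : sum_f_R0 a n = lsum a (seq 0 (S n)).
Proof.
  induction n as [|n IH]; [simpl; ring|].
  rewrite seq_S, lsum_app, <- IH; simpl; ring.
Qed.

(** With nonnegative terms the sum is the supremum of the sums over finite index sets, a description
    free of order. *)
Lemma infinite_sum_lsum a t : (forall i, 0 <= a i) ->
  infinite_sum a t <->
  (forall l, NoDup l -> lsum a l <= t) /\
  (forall eps, 0 < eps -> exists l, NoDup l /\ t - eps < lsum a l).
Proof.
  intros Ha; split.
  - intros H; split.
    + intros l Hl; apply Rle_trans with (sum_f_R0 a (list_max l)).
      * rewrite sum_f_R0_lsum; apply lsum_incl; [exact Ha|exact Hl|].
        intros i Hi; apply in_seq.
        pose proof (proj1 (list_max_le l (list_max l)) (Nat.le_refl _)) as F.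
        rewrite Forall_forall in F; specialize (F i Hi); lia.
      * apply sum_incr; [exact H|exact Ha].
    + intros eps He; destruct (H eps He) as [N HN].
      specialize (HN N (Nat.le_refl N)); apply Rabs_def2 in HN.
      exists (seq 0 (S N)); split; [apply seq_NoDup|].
      rewrite <- sum_f_R0_lsum; lra.
  - intros [H1 H2] eps He; destruct (H2 eps He) as [l [Hl Hs]].
    exists (list_max l); intros n Hn.
    assert (lsum a l <= sum_f_R0 a n).
    { rewrite sum_f_R0_lsum; apply lsum_incl; [exact Ha|exact Hl|].
      intros i Hi; apply in_seq.
      pose proof (proj1 (list_max_le l (list_max l)) (Nat.le_refl _)) as F.
      rewrite Forall_forall in F; specialize (F i Hi); lia. }
    pose proof (H1 (seq 0 (S n)) (seq_NoDup _ _)) as U; rewrite <- sum_f_R0_lsum in U.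
    apply Rabs_def1; lra.
Qed.

Lemma infinite_sum_permute a (s s' : nat -> nat) t :
  (forall i, 0 <= a i) -> (forall i, s (s' i) = i) -> (forall i, s' (s i) = i) ->
  infinite_sum a t <-> infinite_sum (fun i => a (s i)) t.
Proof.
  intros Ha H1 H2; rewrite !infinite_sum_lsum by auto.
  assert (Is : Injective s) by (intros i j E; rewrite <- (H2 i), <- (H2 j), E; reflexivity).
  assert (Is' : Injective s') by (intros i j E; rewrite <- (H1 i), <- (H1 j), E; reflexivity).
  assert (M : forall l, lsum (fun i => a (s i)) (map s' l) = lsum a l).
  { intros l; rewrite lsum_map; induction l as [|i l IH]; simpl; [reflexivity|].
    rewrite H1, IH; reflexivity. }
  split; intros [U A]; split.
  - intros l Hl; rewrite <- lsum_map; apply U, Injective_map_NoDup; assumption.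
  - intros eps He; destruct (A eps He) as [l [Hl ?]]; exists (map s' l).
    rewrite M; split; [apply Injective_map_NoDup|]; assumption.
  - intros l Hl; rewrite <- M; apply U, Injective_map_NoDup; assumption.
  - intros eps He; destruct (A eps He) as [l [Hl ?]]; exists (map s l).
    rewrite lsum_map; split; [apply Injective_map_NoDup|]; assumption.
Qed.

Lemma card_is_bij (P Q : (nat -> bool) -> Prop) (phi psi : (nat -> bool) -> nat -> bool) v :
  (forall e, phi (psi e) = e) -> (forall e, psi (phi e) = e) ->
  (forall e, Q e <-> P (psi e)) -> card_is P v -> card_is Q v.
Proof.
  intros H1 H2 HQ.
  assert (Ip : forall a b, phi a = phi b -> a = b)
    by (intros a b E; rewrite <- (H2 a), <- (H2 b), E; reflexivity).
  destruct v as [n| |]; simpl.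
  - intros [l [Hl [<- E]]]; exists (map phi l); repeat split.
    + apply Injective_map_NoDup; assumption.
    + apply length_map.
    + rewrite HQ, E, in_map_iff; intros He; exists (psi e); auto.
    + rewrite HQ, E, in_map_iff; intros [e' [<- He']]; rewrite H2; exact He'.
  - intros [f [If E]]; exists (fun i => phi (f i)); split; [auto|].
    intros e; rewrite HQ, E; split; intros [i Hi]; exists i.
    + rewrite Hi; apply H1.
    + rewrite <- Hi; symmetry; apply H2.
  - intros [f [If E]]; exists (fun i => phi (f i)); split; [auto|].
    intros e; rewrite HQ, E; split; intros [i Hi]; exists i.
    + rewrite Hi; apply H1.
    + rewrite <- Hi; symmetry; apply H2.
Qed.

Lemma card_is_ext (P Q : (nat -> bool) -> Prop) v :
  (forall e, P e <-> Q e) -> card_is P v <-> card_is Q v.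
Proof.
  intros H; split; apply card_is_bij with (phi := fun e => e) (psi := fun e => e); firstorder.
Qed.

(** Precomposition with [s] is a bijection between the representations of each target. *)
Lemma cardinal_range_permute x (s s' : nat -> nat) M :
  (forall i, 0 < x i) -> (forall i, s (s' i) = i) -> (forall i, s' (s i) = i) ->
  cardinal_range x M -> cardinal_range (fun i => x (s i)) M.
Proof.
  intros Hx H1 H2 HM v; rewrite (HM v).
  assert (A : forall e t, subsum_is x e t <->
    subsum_is (fun i => x (s i)) (fun i => e (s i)) t).
  { intros e t; apply (infinite_sum_permute (fun i => if e i then x i else 0)) with s'; auto.
    intros i; specialize (Hx i); destruct (e i); lra. }
  assert (K1 : forall e : nat -> bool, (fun i => e (s (s' i))) = e)
    by (intros e; apply functional_extensionality; intros i; rewrite H1; reflexivity).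
  assert (K2 : forall e : nat -> bool, (fun i => e (s' (s i))) = e)
    by (intros e; apply functional_extensionality; intros i; rewrite H2; reflexivity).
  assert (B : forall t, achievement x t <-> achievement (fun i => x (s i)) t).
  { intros t; split; intros [e He].
    - exists (fun i => e (s i)); apply A, He.
    - exists (fun i => e (s' i)); apply A; rewrite K2; exact He. }
  assert (C : forall t, card_is (reps x t) v <-> card_is (reps (fun i => x (s i)) t) v).
  { intros t; split.
    - apply card_is_bij with (phi := fun e i => e (s i)) (psi := fun e i => e (s' i)); auto.
      intros e; unfold reps; rewrite A, K2; reflexivity.
    - apply card_is_bij with (phi := fun e i => e (s' i)) (psi := fun e i => e (s i)); auto.
      intros e; unfold reps; apply A. }
  split; intros [t Ht]; exists t; [rewrite <- B, <- C|rewrite B, C]; exact Ht.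
Qed.

(** * Tail sums, Kakeya's condition and sorting *)

Fixpoint remainder (x : nat -> R) (T : R) (n : nat) : R :=
  match n with O => T | S n' => remainder x T n' - x n' end.

Lemma remainder_step x T n : remainder x T n = x n + remainder x T (S n).
Proof. simpl; ring. Qed.

Lemma remainder_sum x T n : remainder x T (S n) = T - sum_f_R0 x n.
Proof. induction n as [|n IH]; [reflexivity|]. rewrite tech5; simpl in *; lra. Qed.

Section Summable.
Variables (x : nat -> R) (T : R).
Hypothesis x_pos : forall n, 0 < x n.
Hypothesis x_sum : infinite_sum x T.
Let r := remainder x T.

Lemma remainder_nonneg n : 0 <= r n.
Proof.
  assert (A : forall k, 0 <= r (S k)).
  { intros k; unfold r; rewrite remainder_sum.
    pose proof (sum_incr x k T x_sum (fun i => Rlt_le _ _ (x_pos i))); lra. }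
  destruct n as [|n]; [|apply A].
  unfold r; rewrite remainder_step; specialize (A 0%nat); specialize (x_pos 0%nat).
  unfold r in A; lra.
Qed.

Lemma remainder_small eps : 0 < eps -> exists N, forall n, (N <= n)%nat -> r n < eps.
Proof.
  intros He; destruct (x_sum eps He) as [N HN]; exists (S N); intros [|n] Hn; [lia|].
  unfold r; rewrite remainder_sum; specialize (HN n ltac:(lia)); apply Rabs_def2 in HN; lra.
Qed.

Lemma terms_small eps : 0 < eps -> exists N, forall n, (N <= n)%nat -> x n < eps.
Proof.
  intros He; destruct (remainder_small eps He) as [N HN]; exists N; intros n Hn.
  specialize (HN n Hn); unfold r in HN; rewrite remainder_step in HN.
  pose proof (remainder_nonneg (S n)); unfold r in *; lra.
Qed.

Lemma node_sum_snoc e k :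
  node_sum x 0 (prefix e (S k)) = node_sum x 0 (prefix e k) + (if e k then x k else 0).
Proof. rewrite prefix_snoc, node_sum_app, prefix_length; simpl; ring. Qed.

Lemma node_sum_prefix (e : nat -> bool) k :
  sum_f_R0 (fun i => if e i then x i else 0) k = node_sum x 0 (prefix e (S k)).
Proof.
  induction k as [|k IH]; [simpl; ring|].
  rewrite tech5, IH, (node_sum_snoc e (S k)); reflexivity.
Qed.

(** The partial sums of the selected terms stay below [t] and those of the omitted terms below
    [T - t]: these are the two bounds of [live]. Conversely, liveness bounds the error by a tail. *)
Lemma subsum_is_rep e t : subsum_is x e t <-> rep x r 0 t e.
Proof.
  split.
  - intros H.
    assert (A : forall k, live x r 0 t (prefix e (S k))).
    { intros k; unfold live; rewrite prefix_length, <- node_sum_prefix.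
      unfold r; rewrite (remainder_sum x T k : remainder x T (0 + S k) = _).
      assert (C : infinite_sum (fun i => x i - (if e i then x i else 0)) (T - t)).
      { intros eps He; destruct (CV_minus _ _ _ _ x_sum H eps He) as [N HN].
        exists N; intros n Hn; rewrite minus_sum; exact (HN n Hn). }
      pose proof (sum_incr _ k _ C) as U; rewrite minus_sum in U.
      pose proof (sum_incr _ k _ H) as V.
      assert (forall n, 0 <= x n - (if e n then x n else 0))
        by (intros n; specialize (x_pos n); destruct (e n); lra).
      assert (forall n, 0 <= (if e n then x n else 0))
        by (intros n; specialize (x_pos n); destruct (e n); lra).
      specialize (U ltac:(assumption)); specialize (V ltac:(assumption)); lra. }
    intros [|k]; [|apply A].
    specialize (A 0%nat); unfold live in *; simpl in *; specialize (x_pos 0%nat).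
    pose proof (remainder_step x T 0 : r 0%nat = x 0%nat + r 1%nat).
    destruct (e 0%nat); lra.
  - intros H eps He; destruct (remainder_small eps He) as [N HN]; exists N; intros k Hk.
    specialize (H (S k)); unfold live in H.
    rewrite prefix_length, <- node_sum_prefix in H.
    specialize (HN (0 + S k)%nat ltac:(lia)).
    apply Rabs_def1; lra.
Qed.

Lemma zero_achieved : achievement x 0.
Proof.
  exists (fun _ => false); intros eps He; exists 0%nat; intros n _.
  replace (sum_f_R0 _ n) with 0; [rewrite Rdist_eq; exact He|].
  induction n as [|n IH]; simpl; [reflexivity|rewrite <- IH; ring].
Qed.

Lemma total_achieved : achievement x T.
Proof. exists (fun _ => true); exact x_sum. Qed.

(** A target strictly between [r (S n)] and [x n] could use no term up to index [n], all being at
    least [x n], while the later ones do not suffice. *)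
Lemma interval_kakeya :
  (forall m n, (m <= n)%nat -> x n <= x m) ->
  (forall t, 0 <= t <= T -> achievement x t) ->
  forall n, x n <= r (S n).
Proof.
  intros Hdec Hach n; apply Rnot_lt_le; intros Hlt.
  set (t := (x n + r (S n)) / 2).
  assert (Rn : forall k, r k <= T).
  { induction k as [|k IH]; unfold r in *; simpl; [lra|specialize (x_pos k); lra]. }
  specialize (Rn n).
  unfold r in Rn; rewrite remainder_step in Rn; fold r in Rn.
  pose proof (remainder_nonneg (S n)).
  destruct (Hach t ltac:(unfold t; lra)) as [e He].
  apply subsum_is_rep in He.
  assert (F : forall k, (k <= S n)%nat -> node_sum x 0 (prefix e k) = 0).
  { induction k as [|k IH]; intros Hk; [reflexivity|].
    rewrite node_sum_snoc, IH by lia.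
    destruct (e k) eqn:Ek; [exfalso|ring].
    pose proof (He (S k)) as L; unfold live in L.
    rewrite node_sum_snoc, IH, Ek in L by lia.
    specialize (Hdec k n ltac:(lia)); unfold t in L; lra. }
  specialize (He (S n)); unfold live in He.
  rewrite F, prefix_length in He by lia; simpl (0 + _)%nat in He; unfold t in He; lra.
Qed.

Lemma maximal_unused (l : list nat) :
  exists n, ~ In n l /\ forall m, ~ In m l -> x m <= x n.
Proof.
  set (m0 := S (list_max l)).
  assert (H0 : ~ In m0 l).
  { intros Hi; pose proof (proj1 (list_max_le l (list_max l)) (Nat.le_refl _)) as F.
    rewrite Forall_forall in F; specialize (F m0 Hi); unfold m0 in F; lia. }
  destruct (terms_small (x m0) (x_pos m0)) as [N HN].
  assert (A : forall K, exists n, ~ In n l /\ x m0 <= x n /\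
    forall m, (m < K)%nat -> ~ In m l -> x m <= x n).
  { induction K as [|K [n [H1 [H2 H3]]]].
    - exists m0; repeat split; [exact H0|lra|lia].
    - destruct (classic (~ In K l /\ x n < x K)) as [[H4 H5]|H4].
      + exists K; repeat split; [exact H4|lra|].
        intros m Hm Hi; destruct (Nat.eq_dec m K) as [->|]; [lra|].
        specialize (H3 m ltac:(lia) Hi); lra.
      + exists n; repeat split; [exact H1|exact H2|].
        intros m Hm Hi; destruct (Nat.eq_dec m K) as [->|]; [|apply H3; [lia|exact Hi]].
        apply Rnot_lt_le; intros Hlt; apply H4; auto. }
  destruct (A N) as [n [H1 [H2 H3]]]; exists n; split; [exact H1|].
  intros m Hm; destruct (Nat.lt_ge_cases m N) as [Hl|Hg]; [apply H3; assumption|].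
  specialize (HN m Hg); lra.
Qed.

Lemma sorting_permutation : exists s s' : nat -> nat,
  (forall i, s (s' i) = i) /\ (forall i, s' (s i) = i) /\
  forall m n, (m <= n)%nat -> x (s n) <= x (s m).
Proof.
  destruct (choice _ maximal_unused) as [next Hnext].
  set (used := nat_rect (fun _ => list nat) nil (fun _ l => next l :: l)).
  set (s := fun k => next (used k)).
  assert (Hused : forall i j, (i < j)%nat -> In (s i) (used j)).
  { intros i j Hij; induction Hij as [|j Hij IH]; [left; reflexivity|right; exact IH]. }
  assert (Hfresh : forall n k, (forall i, (i < k)%nat -> s i <> n) -> ~ In n (used k)).
  { intros n k; induction k as [|k IH]; intros H; [simpl; tauto|].
    intros [E|Hi]; [exact (H k ltac:(lia) E)|].
    apply IH; [intros i Hk; apply H; lia|exact Hi]. }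
  assert (Hlt : forall i j, (i < j)%nat -> s i <> s j).
  { intros i j Hij E; apply (proj1 (Hnext (used j))); fold (s j); rewrite <- E.
    apply Hused, Hij. }
  assert (Hinj : forall i j, s i = s j -> i = j).
  { intros i j E; destruct (Nat.lt_trichotomy i j) as [H|[H|H]]; [exfalso|exact H|exfalso].
    - exact (Hlt i j H E).
    - exact (Hlt j i H (eq_sym E)). }
  assert (Hmax : forall n k, (forall i, (i < k)%nat -> s i <> n) -> x n <= x (s k)).
  { intros n k H; apply (proj2 (Hnext (used k))), Hfresh, H. }
  assert (Hsurj : forall n, exists i, s i = n).
  { intros n; apply NNPP; intros H.
    destruct (terms_small (x n) (x_pos n)) as [N HN].
    assert (B : forall k, (s k < N)%nat).
    { intros k; apply Nat.nle_gt; intros Hk; specialize (HN _ Hk).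
      assert (x n <= x (s k)); [|lra].
      apply Hmax; intros i _ E; apply H; exists i; exact E. }
    assert (L : (length (map s (seq 0 (S N))) <= length (seq 0 N))%nat).
    { apply NoDup_incl_length.
      - apply Injective_map_NoDup; [exact Hinj|apply seq_NoDup].
      - intros m Hm; apply in_map_iff in Hm; destruct Hm as [k [<- _]].
        apply in_seq; specialize (B k); lia. }
    rewrite length_map, !length_seq in L; lia. }
  destruct (choice _ Hsurj) as [s' Hs'].
  exists s, s'; repeat split.
  - exact Hs'.
  - intros i; apply Hinj, Hs'.
  - intros m n Hmn; apply Hmax; intros i Hi E; apply Hinj in E; lia.
Qed.

End Summable.

(** * Reduction to sorted sequences and conclusion *)

Lemma in_I1_sorted M : in_I1 M -> exists x T,
  (forall n, 0 < x n) /\ infinite_sum x T /\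
  (forall t, 0 <= t <= T -> achievement x t) /\
  (forall m n, (m <= n)%nat -> x n <= x m) /\ cardinal_range x M.
Proof.
  intros [x [[Hx [T HS]] [[a [b [_ Hab]]] HM]]].
  destruct (sorting_permutation x T Hx HS) as [s [s' [H1 [H2 Hdec]]]].
  exists (fun i => x (s i)), T.
  assert (HS' : infinite_sum (fun i => x (s i)) T).
  { apply infinite_sum_permute with s'; auto; intros i; apply Rlt_le, Hx. }
  repeat split.
  - intros n; apply Hx.
  - exact HS'.
  - intros t Ht.
    (* The interval [[a, b]] contains the empty sum 0 and the full sum [T]. *)
    assert (Ha : achievement x t).
    { apply Hab; pose proof (proj1 (Hab 0) (zero_achieved x)).
      pose proof (proj1 (Hab T) (total_achieved x T HS)); lra. }
    destruct Ha as [e He]; exists (fun i => e (s i)).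
    apply (infinite_sum_permute (fun i => if e i then x i else 0) s s'); auto.
    intros i; specialize (Hx i); destruct (e i); lra.
  - exact Hdec.
  - apply (cardinal_range_permute x s s' M Hx H1 H2 HM).
  - apply (cardinal_range_permute x s s' M Hx H1 H2 HM).
Qed.

Theorem theorem7p7 (M : cval -> Prop) :
  in_I1 M -> bounded_cset M -> ~ M (Fin 4) ->
  (exists n, (5 <= n)%nat /\ M (Fin n)) ->
  exists n, (7 <= n)%nat /\ M (Fin n).
Proof.
  intros HI [N HN] H4 [n5 [Hn5 M5]].
  destruct (in_I1_sorted M HI) as [x [T [Hx [HS [Hach [Hdec HM]]]]]].
  set (r := remainder x T).
  pose proof (remainder_nonneg x T Hx HS : forall n, 0 <= r n) as r_nonneg.
  pose proof (remainder_small x T HS : forall eps, 0 < eps ->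
    exists N, forall n, (N <= n)%nat -> r n < eps) as r_small.
  pose proof (remainder_step x T : forall n, r n = x n + r (S n)) as r_step.
  pose proof (interval_kakeya x T Hx HS Hdec Hach : forall n, x n <= r (S n)) as kakeya.
  assert (Hcard : forall t v, card_is (reps x t) v <-> card_is (rep x r 0 t) v).
  { intros t v; apply card_is_ext; intros e; apply subsum_is_rep; assumption. }
  destruct (rep_dichotomy x r Hx r_step r_nonneg r_small kakeya)
    as [[t [Ht HC]]|[c [L [Hc HL]]]].
  { assert (MC : M Cont) by (apply HM; exists t; split; [apply Hach, Ht|apply Hcard, HC]).
    destruct (HN _ MC) as [k [E _]]; discriminate E. }
  apply NNPP; intros H7.
  (* The value 0 must be set aside: it marks targets outside the achievement set. *)
  assert (Hin : forall t, stack c L t <> 0%nat -> M (Fin (stack c L t))).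
  { intros t Ht; apply HM; exists t; split; [|apply Hcard, HL].
    destruct (HL t) as [l [_ [El Hl]]].
    destruct l as [|e l]; [exfalso; apply Ht; symmetry; exact El|].
    exists e; apply (subsum_is_rep x T Hx HS), Hl; left; reflexivity. }
  assert (Hout : forall t, ~ 0 <= t <= T -> stack c L t = 0%nat).
  { intros t Ht; apply (card_is_unique (rep x r 0 t)); [apply HL|].
    apply card_rep_out; assumption. }
  assert (E : exists t, stack c L t = n5).
  { apply HM in M5; destruct M5 as [t [_ Ht]]; exists t.
    apply (card_is_unique (rep x r 0 t)); [apply HL|apply Hcard, Ht]. }
  destruct E as [t Et].
  assert (B : (stack c L t <= 3)%nat); [|lia].
  apply (stack_le_3 c T L Hc).
  - intros u Hu; apply Hout; lra.
  - intros u Hu; apply Hout; lra.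
  - intros u Hu; apply Nat.neq_0_lt_0; intros E0.
    destruct (HL u) as [l [_ [El Hl]]]; rewrite E0 in El.
    destruct l as [|e l]; [|discriminate El].
    apply (Hl (greedy x 0 u)), greedy_rep; assumption.
  - apply (card_is_unique (rep x r 0 0)); [apply HL|].
    apply card_rep_0; assumption.
  - intros u Eu; apply H4; rewrite <- Eu; apply Hin; lia.
  - intros u; apply Nat.nlt_ge; intros Hu; apply H7; exists (stack c L u).
    split; [lia|apply Hin; lia].
Qed.
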